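(* Let $N\in\mathbb{N}$, $\tau\in\mathbb{N}_0$, let $r\le-\tau$ be an integer, and for $i,j\in\{1,\ldots,N\}$ let $c_i:\mathbb{N}_0\to(-1,1)$ and $h_{ij}:\mathbb{N}_0\times X^N\to\mathbb{R}$ be functions. Assume that for each $i,j\in\{1,\ldots,N\}$ there is a positive constant $H_{ij}$ such that $$|h_{ij}(m,\overline\alpha)-h_{ij}(m,\overline\beta)|\le H_{ij}\|\overline\alpha-\overline\beta\|\qquad\text{for all }m\in\mathbb{N}_0,\ \overline\alpha,\overline\beta\in X^N.$$ If $$1-c_i^+>\sum_{j=1}^N H_{ij}\qquad\text{for all }i\in\{1,\ldots,N\},$$ where $c_i^+=\sup_{m\in\mathbb{N}_0}|c_i(m)|$, then the model $$x_i(m+1)=c_i(m)\,x_i(m-\tau)+\sum_{j=1}^N h_{ij}(m,\overline{x}_m),\qquad m\in\mathbb{N}_0,\ i=1,\ldots,N,$$ is globally exponentially stable.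
   Context: $\mathbb{N}=\{1,2,\ldots\}$, $\mathbb{N}_0=\mathbb{N}\cup\{0\}$. For $I\subseteq\mathbb{R}$, $I_{\mathbb{Z}}=I\cap\mathbb{Z}$. $X$ is the space of functions $\alpha:[r,0]_{\mathbb{Z}}\to\mathbb{R}$ with norm $\|\alpha\|=\max_{j=r,\ldots,0}|\alpha(j)|$. $X^N$ carries the norm $\|\overline\alpha\|=\max_{i=1,\ldots,N}\|\alpha_i\|$ for $\overline\alpha=(\alpha_1,\ldots,\alpha_N)$. For $\overline{x}=(x_1,\ldots,x_N):[r,+\infty)_{\mathbb{Z}}\to\mathbb{R}^N$ and $m\in\mathbb{N}_0$, $\overline{x}_m\in X^N$ is defined by $\overline{x}_m(j)=\overline{x}(m+j)$, $j=r,\ldots,0$. For $\overline\alpha\in X^N$, $\overline{x}(\cdot,\overline\alpha):[r,+\infty)_{\mathbb{Z}}\to\mathbb{R}^N$ is the unique solution with initial condition $\overline{x}_0=\overline\alpha$, and $\overline{x}_m(\cdot,\overline\alpha)$ is its segment at time $m$. The model is globally exponentially stable if there are $C>0$ and $\zeta\in(0,1)$ such that $\|\overline{x}_m(\cdot,\overline\alpha)-\overline{x}_m(\cdot,\overline\beta)\|\le C\zeta^m\|\overline\alpha-\overline\beta\|$ for all $\overline\alpha,\overline\beta\in X^N$ and $m\in\mathbb{N}_0$. *)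

(* Defs.v *)
From HB Require Import structures.
From mathcomp Require Import all_boot all_order all_algebra.
From mathcomp Require Import all_classical all_reals.
From mathcomp Require Import zify.

Set Implicit Arguments.
Unset Strict Implicit.
Unset Printing Implicit Defensive.

Import Order.TTheory GRing.Theory Num.Theory.
Local Open Scope classical_set_scope.
Local Open Scope ring_scope.

Definition past (r : int) : Type := {j : int | j \in `[r, 0]}.
Definition times (r : int) : Type := {k : int | k \in `[r, +oo[}.

Definition past_rank (r : int) (j : past r) : 'I_(`|r|.+1) := inord `|val j|.
Definition past_unrank (r : int) (k : 'I_(`|r|.+1)) : option (past r) :=
  insub (- (k : nat)%:Z).

Lemma past_rankK (r : int) : pcancel (@past_rank r) (@past_unrank r).
Proof.
move=> [j jP]; rewrite /past_rank /past_unrank /=.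
have /andP[rj j0] : (r <= j) && (j <= 0) by move: jP; rewrite in_itv.
have jr : (`|j| < `|r|.+1)%N by lia.
have jE : - (inord `|j| : 'I_(`|r|.+1))%:Z = j by rewrite inordK //; lia.
by rewrite jE insubT; congr Some; exact: val_inj.
Qed.

HB.instance Definition _ (r : int) := Countable.on (past r).
HB.instance Definition _ (r : int) : isFinite (past r) :=
  PCanIsFinite (@past_rankK r).

Definition X (R : realType) (r : int) : Type := past r -> R.
Definition XN (R : realType) (r : int) (N : nat) : Type := 'I_N -> X R r.

(* Absolute values are nonnegative, so that 0 is a neutral base value for the
   maxima below, which range over nonempty index sets when r <= 0 and 0 < N. *)
Definition normX (R : realType) (r : int) (a : X R r) : R :=
  \big[Num.max/0]_(j : past r) `|a j|.
Definition normXN (R : realType) (r : int) (N : nat) (a : XN R r N) : R :=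
  \big[Num.max/0]_(i < N) normX (a i).

Definition subXN (R : realType) (r : int) (N : nat) (a b : XN R r N) :
  XN R r N := fun i j => a i j - b i j.

Lemma shift_times (r : int) (m : nat) (j : past r) :
  m%:Z + val j \in `[r, +oo[.
Proof. by have := valP j; rewrite !in_itv /=; lia. Qed.

Lemma next_times (r : int) (tau : nat) (hr : r <= - tau%:Z) (m : nat) :
  m%:Z + 1 \in `[r, +oo[.
Proof. by rewrite in_itv /=; lia. Qed.

Lemma lag_times (r : int) (tau : nat) (hr : r <= - tau%:Z) (m : nat) :
  m%:Z - tau%:Z \in `[r, +oo[.
Proof. by rewrite in_itv /=; lia. Qed.

Definition time (r k : int) (hk : k \in `[r, +oo[) : times r := exist _ k hk.

Definition trajectory (R : realType) (r : int) (N : nat) : Type :=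
  times r -> 'I_N -> R.

Definition segment (R : realType) (r : int) (N : nat) (x : trajectory R r N)
  (m : nat) : XN R r N := fun i j => x (time (shift_times m j)) i.

Definition is_solution (R : realType) (N tau : nat) (r : int)
    (hr : r <= - tau%:Z) (c : 'I_N -> nat -> R)
    (h : 'I_N -> 'I_N -> nat -> XN R r N -> R) (x : trajectory R r N) : Prop :=
  forall (m : nat) (i : 'I_N),
    x (time (next_times hr m)) i =
    c i m * x (time (lag_times hr m)) i + \sum_(j < N) h i j m (segment x m).

Definition is_solution_from (R : realType) (N tau : nat) (r : int)
    (hr : r <= - tau%:Z) (c : 'I_N -> nat -> R)
    (h : 'I_N -> 'I_N -> nat -> XN R r N -> R) (a : XN R r N)
    (x : trajectory R r N) : Prop :=
  is_solution hr c h x /\ segment x 0 = a.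

Lemma timeE (r : int) (k : times r) (l : int) (hl : l \in `[r, +oo[) :
  val k = l -> k = time hl.
Proof. by move=> kl; exact: val_inj. Qed.

Lemma is_solution_from_exists (R : realType) (N tau : nat) (r : int)
    (hr : r <= - tau%:Z) (c : 'I_N -> nat -> R)
    (h : 'I_N -> 'I_N -> nat -> XN R r N -> R) (a : XN R r N) :
  exists x, is_solution_from hr c h a x.
Proof.
pose nxt (m : nat) (y : int -> 'I_N -> R) (k : int) (i : 'I_N) : R :=
  if k == m%:Z + 1 then
    c i m * y (m%:Z - tau%:Z) i +
    \sum_(j < N) h i j m (fun i' j' => y (m%:Z + val j') i')
  else y k i.
pose y0 (k : int) (i : 'I_N) : R :=
  if insub k is Some j then a i (j : past r) else 0.
pose y := fix y (m : nat) := if m is n.+1 then nxt n (y n) else y0.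
have yst (m d : nat) k : k <= m%:Z -> y (m + d)%N k = y m k.
  move=> km; elim: d => [|d IH]; first by rewrite addn0.
  rewrite addnS /= -IH; apply/funext => i; rewrite /nxt; case: eqP => // kE.
  by exfalso; move: kE km; lia.
pose n (k : int) : nat := if k is Posz p then p else 0%N.
have yn (m : nat) k : k <= m%:Z -> y (n k) k = y m k.
  move=> km; have nm : (n k <= m)%N by case: k km => //= p; lia.
  have kn : k <= (n k)%:Z by case: k {km nm}.
  by rewrite -(subnKC nm) yst.
exists (fun k => y (n (val k)) (val k)); split.
  move=> m i /=.
  have e1 : y (n (m%:Z + 1)) (m%:Z + 1) = y m.+1 (m%:Z + 1).
    by apply: yn; lia.
  have e2 : y (n (m%:Z - tau%:Z)) (m%:Z - tau%:Z) = y m (m%:Z - tau%:Z).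
    by apply: yn; lia.
  rewrite e1 e2 /= {1}/nxt eqxx.
  congr (_ + _); apply: eq_bigr => j _; congr (h i j m _).
  apply/funext => i'; apply/funext => j'; rewrite /segment /= (yn m) //.
  by have := valP j'; rewrite in_itv /=; lia.
apply/funext => i; apply/funext => j; rewrite /segment /= add0r (yn 0%N).
  by rewrite /= /y0 valK.
by have := valP j; rewrite in_itv /=; lia.
Qed.

Lemma is_solution_from_unique (R : realType) (N tau : nat) (r : int)
    (hr : r <= - tau%:Z) (c : 'I_N -> nat -> R)
    (h : 'I_N -> 'I_N -> nat -> XN R r N -> R) (a : XN R r N)
    (x y : trajectory R r N) :
  is_solution_from hr c h a x -> is_solution_from hr c h a y -> x = y.
Proof.
move=> [xs x0] [ys y0].
have xy (m : nat) (k : times r) : val k <= m%:Z -> x k = y k.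
  elim: m k => [|m IH] k km; apply/funext => i.
    have kP : val k \in `[r, 0].
      by have := valP k; rewrite !in_itv /= andbT => ->.
    pose j : past r := exist _ (val k) kP.
    have := congr1 (fun s : XN R r N => s i j) (etrans x0 (esym y0)).
    by rewrite /segment -(@timeE r k _ (shift_times 0 j)) //= add0r.
  have [/IH -> //|mk] := leP (val k) m%:Z.
  have kE : val k = m%:Z + 1 by lia.
  rewrite (timeE (next_times hr m) kE) xs ys IH; last by rewrite /=; lia.
  congr (_ + _); apply: eq_bigr => j _; congr (h i j m _).
  apply/funext => i'; apply/funext => j'; rewrite /segment IH //=.
  by have := valP j'; rewrite in_itv /=; lia.
by apply/funext => k; apply: (xy `|val k|%N); lia.
Qed.

(* The solution with initial segment a: the default value 0 is irrelevant,
   see [solutionP] and [is_solution_from_unique]. *)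
Definition solution (R : realType) (N tau : nat) (r : int)
    (hr : r <= - tau%:Z) (c : 'I_N -> nat -> R)
    (h : 'I_N -> 'I_N -> nat -> XN R r N -> R) (a : XN R r N) :
    trajectory R r N :=
  xget (fun _ _ => 0) [set x | is_solution_from hr c h a x].

Lemma solutionP (R : realType) (N tau : nat) (r : int)
    (hr : r <= - tau%:Z) (c : 'I_N -> nat -> R)
    (h : 'I_N -> 'I_N -> nat -> XN R r N -> R) (a : XN R r N) :
  is_solution_from hr c h a (solution hr c h a).
Proof.
have [x xs] := is_solution_from_exists hr c h a.
exact: (xgetPex (P := [set x | is_solution_from hr c h a x]) _ (ex_intro _ x xs)).
Qed.

Definition globally_exponentially_stable (R : realType) (N tau : nat) (r : int)
    (hr : r <= - tau%:Z) (c : 'I_N -> nat -> R)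
    (h : 'I_N -> 'I_N -> nat -> XN R r N -> R) : Prop :=
  exists C zeta : R, [/\ 0 < C, 0 < zeta < 1 &
    forall (a b : XN R r N) (m : nat),
      normXN (subXN (segment (solution hr c h a) m)
                    (segment (solution hr c h b) m))
      <= C * zeta ^+ m * normXN (subXN a b)].

Definition csup (R : realType) (u : nat -> R) : R := sup [set `|u m| | m in setT].

(* Main.v *)
Require Import Defs.
From mathcomp Require Import all_boot all_order all_algebra.
From mathcomp Require Import all_classical all_reals.
From mathcomp Require Import zify lra ring.
Import Order.TTheory GRing.Theory Num.Theory.
Local Open Scope ring_scope.

(** The difference [d] of two solutions satisfies
    [|d_i(m+1)| <= |c_i(m)| |d_i(m-tau)| + \sum_j H_ij ||d_m|| <= rho ||d_m||],
    where [rho < 1] bounds all the [csup (c i) + \sum_j H i j]: the lag [m-tau]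
    lies in the window [m+r, m] of the segment [d_m], as [r <= -tau]
    ([solution_diff_le]).

    One step thus gains a factor [rho] over the maximum of the window, and this
    maximum may be attained as early as time [m+r].  Hence a rate [zeta] is
    sustainable as soon as [rho * zeta ^ (m + r) <= zeta ^ (m + 1)], that is
    [rho <= zeta ^ (1 - r)], and induction on time gives
    [|d_i(k)| <= ||d_0|| * zeta ^ k] at every time [k >= r]
    ([window_contraction_pointwise]).  Taking the maximum over a window costs
    the constant factor [C = zeta ^ r] ([window_contraction]).  By Bernoulli's
    inequality, some [zeta] in (0, 1) is of this kind for every [rho] in (0, 1)
    ([root_majorant]). *)

Section Norms.
Context {R : realType} {r : int} {N : nat}.
Implicit Types a : XN R r N.

Lemma normXN_ge0 a : 0 <= normXN a.
Proof. exact: bigmax_ge_id. Qed.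

Lemma le_normXN a i j : `|a i j| <= normXN a.
Proof.
apply: (@le_trans _ _ (normX (a i))); first exact: (le_bigmax _ (fun j => `|a i j|)).
exact: (le_bigmax _ (fun i => normX (a i))).
Qed.

Lemma normXN_le a M : 0 <= M -> (forall i j, `|a i j| <= M) -> normXN a <= M.
Proof.
by move=> M0 aM; apply/bigmax_leP; split=> // i _; apply/bigmax_leP; split.
Qed.

End Norms.

Lemma bernoulli_le {R : realDomainType} (x : R) n :
  x <= 1 -> 1 - n%:R * x <= (1 - x) ^+ n.
Proof.
move=> x1; elim: n => [|n IH]; first by rewrite expr0 mul0r subr0.
have x1' : 0 <= 1 - x by lra.
rewrite exprS; apply: le_trans (ler_wpM2l x1' IH).
have : 0 <= n%:R * (x * x) by rewrite mulr_ge0 ?ler0n // -expr2 sqr_ge0.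
by rewrite -natr1; nra.
Qed.

Lemma root_majorant {R : realFieldType} (rho : R) n :
  0 < rho < 1 -> exists2 zeta, 0 < zeta < 1 & rho <= zeta ^+ n.+1.
Proof.
move=> /andP[rho0 rho1]; have n0 : 0 < n.+1%:R :> R by rewrite ltr0n.
have n1 : 1 <= n.+1%:R :> R by rewrite ler1n.
(* The defect at which Bernoulli's lower bound is exactly [rho]. *)
pose x := (1 - rho) / n.+1%:R.
have nx : n.+1%:R * x = 1 - rho by rewrite mulrC divfK // gt_eqF.
have x0 : 0 < x by rewrite divr_gt0 // subr_gt0.
have xle : x <= 1 - rho by rewrite -nx ler_peMl // ltW.
exists (1 - x); first by apply/andP; split; lra.
by apply: le_trans (bernoulli_le x n.+1 _); lra.
Qed.

Section WindowContraction.
Context {R : realType} {r : int} {N : nat}.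
Variables (d : trajectory R r N) (rho zeta : R).
Hypothesis r_le0 : r <= 0.
Hypothesis zeta01 : 0 < zeta < 1.
Hypothesis rho_zeta : rho <= zeta ^ (1 - r).
Hypothesis d_step : forall (m : nat) (k : times r) i,
  val k = m%:Z + 1 -> `|d k i| <= rho * normXN (segment d m).

Let M := normXN (segment d 0).

Let zeta_gt0 : 0 < zeta. Proof. by case/andP: zeta01. Qed.

Let zeta_anti (k l : int) : k <= l -> zeta ^ l <= zeta ^ k.
Proof.
move=> kl; case/andP: zeta01 => z0 z1.
have lE : l = k + `|l - k|%N by lia.
rewrite lE expfzDr ?gt_eqF // ler_piMr ?exprz_ge0 ?exprn_ile1 //; exact: ltW.
Qed.

(** A pointwise bound decaying in time is, on the window ending at [m],
    largest at its oldest time [m + r]. *)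
Let segment_le m :
  (forall (k : times r) i, val k <= m%:Z -> `|d k i| <= M * zeta ^ val k) ->
  normXN (segment d m) <= M * zeta ^ (m%:Z + r).
Proof.
move=> dM; apply: normXN_le => [|i j].
  by rewrite mulr_ge0 ?normXN_ge0 // exprz_ge0 // ltW.
have := valP j; rewrite in_itv /= => /andP[rj j0].
apply: le_trans (dM _ _ _) _; first by rewrite /=; lia.
by rewrite ler_wpM2l ?normXN_ge0 // zeta_anti //= lerD2l.
Qed.

(** Induction on time.  On the initial window the exponent is nonpositive, so
    [M * zeta ^ val k] is at least [M], the maximum of [d] there.  At time
    [m + 1], [d_step] and [segment_le] give
    [rho * M * zeta ^ (m + r) <= M * zeta ^ (m + 1)], and this is where the
    exponent [1 - r] in [rho_zeta] comes from. *)
Lemma window_contraction_pointwise (m : nat) (k : times r) i :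
  val k <= m%:Z -> `|d k i| <= M * zeta ^ val k.
Proof.
elim: m k i => [|m IH] k i km.
  have kP : val k \in `[r, 0].
    by have := valP k; rewrite !in_itv /= andbT => ->.
  pose j : past r := exist _ (val k) kP.
  apply: (@le_trans _ _ M).
    have := le_normXN (segment d 0) i j.
    by rewrite {1}/segment -(@timeE r k _ (shift_times 0 j)) //= add0r.
  by rewrite ler_peMr ?normXN_ge0 // -(expr0z zeta) zeta_anti.
have [/IH //|mk] := leP (val k) m%:Z.
have kE : val k = m%:Z + 1 by lia.
apply: (le_trans (d_step _ _ i kE)).
apply: (@le_trans _ _ (zeta ^ (1 - r) * normXN (segment d m))).
  by rewrite ler_wpM2r ?normXN_ge0.
apply: (@le_trans _ _ (zeta ^ (1 - r) * (M * zeta ^ (m%:Z + r)))).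
  by rewrite ler_wpM2l ?segment_le // exprz_ge0 // ltW.
rewrite mulrCA -expfzDr ?gt_eqF // kE.
by have -> : 1 - r + (m%:Z + r) = m%:Z + 1 by lia.
Qed.

Lemma window_contraction m :
  normXN (segment d m) <= zeta ^ r * zeta ^+ m * normXN (segment d 0).
Proof.
have -> : zeta ^ r * zeta ^+ m = zeta ^ (m%:Z + r).
  by rewrite expfzDr ?gt_eqF // mulrC.
rewrite mulrC; apply: segment_le => k i; exact: window_contraction_pointwise.
Qed.

End WindowContraction.

Lemma le_csup {R : realType} (u : nat -> R) (K : R) m :
  (forall n, `|u n| <= K) -> `|u m| <= csup u.
Proof.
move=> uK; apply: ub_le_sup; last by exists m.
by exists K => _ [n _ <-].
Qed.

Lemma solution_diff_le (R : realType) (N tau : nat) (r : int)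
    (hr : r <= - tau%:Z) (c : 'I_N -> nat -> R)
    (h : 'I_N -> 'I_N -> nat -> XN R r N -> R) (H : 'I_N -> 'I_N -> R)
    (x y : trajectory R r N) (m : nat) (i : 'I_N) :
  (forall j a b, `|h i j m a - h i j m b| <= H i j * normXN (subXN a b)) ->
  is_solution hr c h x -> is_solution hr c h y ->
  `|x (time (next_times hr m)) i - y (time (next_times hr m)) i| <=
    (`|c i m| + \sum_(j < N) H i j) *
      normXN (subXN (segment x m) (segment y m)).
Proof.
move=> hLip xs ys; rewrite xs ys.
set s := normXN _; set t := time (lag_times hr m).
have -> (u v w z : R) : u * v + w - (u * z + \sum_(j < N) h i j m (segment y m))
    = u * (v - z) + (w - \sum_(j < N) h i j m (segment y m)) by ring.
rewrite mulrDl; apply: le_trans (ler_normD _ _) _; apply: lerD.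
  rewrite normrM ler_wpM2l //.
  have tauP : - tau%:Z \in `[r, 0] by rewrite in_itv /=; lia.
  pose j : past r := exist _ (- tau%:Z) tauP.
  have := le_normXN (subXN (segment x m) (segment y m)) i j.
  by rewrite {1}/subXN /segment -(@timeE r t).
rewrite -sumrB mulr_suml; apply: le_trans (ler_norm_sum _ _ _) _.
by apply: ler_sum => j _; exact: hLip.
Qed.

Theorem theorem3 (R : realType) (N tau : nat) (r : int)
    (hN : (0 < N)%N) (hr : r <= - tau%:Z)
    (c : 'I_N -> nat -> R) (hc : forall i m, -1 < c i m < 1)
    (h : 'I_N -> 'I_N -> nat -> XN R r N -> R)
    (H : 'I_N -> 'I_N -> R) (hH : forall i j, 0 < H i j)
    (hLip : forall (i j : 'I_N) (m : nat) (a b : XN R r N),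
        `|h i j m a - h i j m b| <= H i j * normXN (subXN a b))
    (hcH : forall i : 'I_N, 1 - csup (c i) > \sum_(j < N) H i j) :
  globally_exponentially_stable hr c h.
Proof.
pose q i := csup (c i) + \sum_(j < N) H i j.
(* The base value 1/2 makes [rho] positive without changing that [rho < 1]. *)
pose rho : R := \big[Num.max/2^-1]_(i < N) q i.
have rho01 : 0 < rho < 1.
  apply/andP; split.
    by apply: (@lt_le_trans _ _ 2^-1); [rewrite invr_gt0 | exact: bigmax_ge_id].
  apply/bigmax_ltP; split; first by lra.
  by move=> i _; have := hcH i; rewrite /q; lra.
have c_rho i m : `|c i m| + \sum_(j < N) H i j <= rho.
  apply: le_trans (le_bigmax _ q i); rewrite lerD2r.
  by apply: (@le_csup _ _ 1) => n; rewrite ltW // ltr_norml hc.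
have [zeta zeta01 rho_zeta] := root_majorant rho `|r|%N rho01.
have zeta0 : 0 < zeta by case/andP: zeta01.
exists (zeta ^ r), zeta; split=> // [|a b m]; first exact: exprz_gt0.
have [xs x0] := solutionP hr c h a; have [ys y0] := solutionP hr c h b.
set x := solution hr c h a in xs x0 *; set y := solution hr c h b in ys y0 *.
rewrite -x0 -y0.
pose d : trajectory R r N := fun k i => x k i - y k i.
apply: (@window_contraction _ _ _ d rho) => // [||n k i kE]; first by lia.
  by have -> : 1 - r = `|r|.+1%:Z by lia.
rewrite (timeE (next_times hr n) kE).
apply: le_trans (solution_diff_le _ _ _ _ _ _ _ H _ _ _ _ _ xs ys) _ => [*|].
  exact: hLip.
by rewrite ler_wpM2r ?normXN_ge0.
Qed.
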